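(* Let $X$ be any dart taking values in $\mathbb{R}$ with characteristic function $\phi_X(t)=E e^{itX}$. Then $(X,\cos(x))$ is reasonable if and only if $|\phi_X(t)|$ is decreasing in $t$ on $[0,\infty)$.
   Context: A dart is a random variable $X$ taking values in $\mathbb{R}$. A payoff function is a measurable function $f:\mathbb{R}\to\mathbb{R}$ bounded from above. For $d>0$, $g_{X,f}(d):=\sup_{a\in\mathbb{R}}Ef(a+dX)$. The pair $(X,f)$ is reasonable if $g_{X,f}(d)$ is decreasing in $d\in(0,\infty)$. Here $(X,\cos(x))$ means $f(x)=\cos(x)$, and ''decreasing'' means non-increasing. *)

(* Defs.v *)
From HB Require Import structures.
From mathcomp Require Import all_boot all_order all_algebra.
From mathcomp Require Import all_classical all_reals all_analysis.
From mathcomp Require Import measurable_realfun complex.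

Set Implicit Arguments.
Unset Strict Implicit.
Unset Printing Implicit Defensive.

Import Order.TTheory GRing.Theory Num.Theory.
Import numFieldNormedType.Exports.

Local Open Scope classical_set_scope.
Local Open Scope complex_scope.
Local Open Scope ring_scope.

Record payoff (R : realType) := Payoff {
  payoff_fun :> R -> R ;
  measurable_payoff : measurable_fun [set: R] payoff_fun ;
  payoff_ubound : has_ubound (range payoff_fun) }.

Lemma measurable_cos (R : realType) : measurable_fun [set: R] (@cos R).
Proof. by apply: continuous_measurable_fun; exact: continuous_cos. Qed.

Lemma has_ubound_cos (R : realType) : has_ubound (range (@cos R)).
Proof. by exists 1 => _ [x _ <-]; exact: cos_le1. Qed.

Definition cos_payoff (R : realType) : payoff R :=
  Payoff (@measurable_cos R) (@has_ubound_cos R).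

(* A payoff need not be bounded from below, so the expectations, and hence
   their supremum, are extended reals: the expectation is -oo when the negative
   part of f (a + d * X) has infinite mean. *)
Definition best_payoff (d : measure_display) (T : measurableType d)
    (R : realType) (P : probability T R) (X : {RV P >-> R}) (f : payoff R)
    (r : R) : \bar R :=
  ereal_sup [set 'E_P[fun w => f (a + r * X w)%R]%E | a in [set: R]].

Definition reasonable (d : measure_display) (T : measurableType d)
    (R : realType) (P : probability T R) (X : {RV P >-> R}) (f : payoff R) :=
  {in `]0, +oo[ &, nonincreasing_fun (best_payoff X f)}.

(* e^(i x), by Euler's formula *)
Definition expi (R : realType) (x : R) : R[i] := cos x +i* sin x.

(* Meaningful only when the real and imaginary parts of Z are integrable. *)
Definition cexpectation (d : measure_display) (T : measurableType d)
    (R : realType) (P : probability T R) (Z : T -> R[i]) : R[i] :=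
  fine 'E_P[fun w => complex.Re (Z w)]%E +i*
  fine 'E_P[fun w => complex.Im (Z w)]%E.

(* `|char_fun X t| is an element of R[i], of the form r%:C with 0 <= r; on such
   elements the partial order of R[i] is the order of R. *)
Definition char_fun (d : measure_display) (T : measurableType d)
    (R : realType) (P : probability T R) (X : {RV P >-> R}) (t : R) : R[i] :=
  cexpectation P (fun w => expi (t * X w)).

(* Main.v *)
Require Import Defs.
From mathcomp Require Import all_boot all_order all_algebra.
From mathcomp Require Import all_classical all_reals all_analysis.
From mathcomp Require Import measurable_realfun complex.

Import Order.TTheory GRing.Theory Num.Theory.
Local Open Scope ring_scope.

(** Write the characteristic function in polar form, phi(t) = r (cos b + i sin b)
    with r = |phi(t)|. By the addition formula and linearity of the expectation,
    E cos(a + t X) = Re (e^(i a) phi(t)) = r cos(a + b)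
    (lemma [expectation_cosD_polar]). As a runs over the reals this oscillates
    between - r and r and attains r at a = - b, so the best payoff at scale t is
    exactly |phi(t)| (lemma [best_payoff_cos]).

    Hence being reasonable is the monotonicity of |phi| on the open half-line.
    The closed half-line adds only comparisons with the point 0, and these hold
    for every dart because |phi(t)| <= 1 = |phi(0)|. *)

(** The modulus vanishes only at the origin, where every angle works; elsewhere
    [acos] gives the angle up to its sign, which is that of [y]. *)
Lemma polar_coordinates (R : realType) (x y : R) :
  exists b, x = Num.sqrt (x ^+ 2 + y ^+ 2) * cos b /\
            y = Num.sqrt (x ^+ 2 + y ^+ 2) * sin b.
Proof.
set r := Num.sqrt _.
have r2 : r ^+ 2 = x ^+ 2 + y ^+ 2 by rewrite sqr_sqrtr// addr_ge0// sqr_ge0.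
have [r0|r_neq0] := eqVneq r 0.
  exists 0; move: r2; rewrite r0 expr0n/= !mul0r => /esym/eqP.
  by rewrite paddr_eq0 ?sqr_ge0// !sqrf_eq0 => /andP[/eqP-> /eqP->].
have r_gt0 : 0 < r by rewrite lt_def r_neq0 sqrtr_ge0.
have xr : `|x / r| <= 1.
  rewrite normrM normfV (gtr0_norm r_gt0) ler_pdivrMr// mul1r.
  by rewrite -sqrtr_sqr ler_wsqrtr// lerDl sqr_ge0.
have yr : r * Num.sqrt (1 - (x / r) ^+ 2) = `|y|.
  rewrite -[X in X * _](gtr0_norm r_gt0) -sqrtr_sqr -sqrtrM ?sqr_ge0//.
  rewrite mulrBr mulr1 expr_div_n mulrCA divff ?expf_neq0// mulr1 r2.
  by rewrite addrC addKr sqrtr_sqr.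
have cosb : r * cos (acos (x / r)) = x.
  by rewrite acosK ?in_itv/= -?ler_norml// mulrC divfK.
have sinb : r * sin (acos (x / r)) = `|y| by rewrite sin_acos -?ler_norml.
have [y0|y0] := leP 0 y.
  by exists (acos (x / r)); rewrite cosb sinb ger0_norm.
exists (- acos (x / r)).
by rewrite cosN sinN mulrN cosb sinb ltr0_norm// opprK.
Qed.

Lemma norm_cos_le1 (R : realType) (x : R) : `|cos x| <= 1.
Proof. by rewrite ler_norml cos_geN1 cos_le1. Qed.

Lemma norm_sin_le1 (R : realType) (x : R) : `|sin x| <= 1.
Proof. by rewrite ler_norml sin_geN1 sin_le1. Qed.

Lemma measurable_sin (R : realType) : measurable_fun setT (@sin R).
Proof. by apply: continuous_measurable_fun; exact: continuous_sin. Qed.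

Section CharacteristicFunction.
Context (d : measure_display) (T : measurableType d) (R : realType).
Context (P : probability T R) (X : {RV P >-> R}).

Lemma integrable_bounded_comp (f : R -> R) (a t : R) :
  measurable_fun setT f -> (forall x, `|f x| <= 1) ->
  P.-integrable setT (EFin \o (fun w => f (a + t * X w))).
Proof.
move=> mf f1; apply: measurable_bounded_integrable => //.
- exact: fin_num_fun_lty.
- apply: measurableT_comp => //.
  by apply: measurable_funD => //; apply: measurable_funM.
- by exists 1; split=> // M M1 w _ /=; rewrite (le_trans (f1 _))// ltW.
Qed.

Let integrable_cos a t :=
  integrable_bounded_comp cos a t (@measurable_cos R) (norm_cos_le1 R).
Let integrable_sin a t :=
  integrable_bounded_comp sin a t (measurable_sin R) (norm_sin_le1 R).

Lemma fine_expectation (f : T -> R) :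
  fine ('E_P[f])%E = \int[P]_w f w.
Proof. by rewrite unlock. Qed.

Lemma expectation_cosD (a t : R) :
  ('E_P[fun w => cos (a + t * X w)%R])%E =
  (cos a * complex.Re (char_fun X t) - sin a * complex.Im (char_fun X t))%:E.
Proof.
have icos : P.-integrable setT (EFin \o (fun w => cos (t * X w))).
  by have := integrable_cos 0 t; under eq_fun do rewrite /= add0r.
have isin : P.-integrable setT (EFin \o (fun w => sin (t * X w))).
  by have := integrable_sin 0 t; under eq_fun do rewrite /= add0r.
rewrite /= !fine_expectation -!RintegralZl// -RintegralB//; last 2 first.
- exact: (integrableZl measurableT _ icos).
- exact: (integrableZl measurableT _ isin).
under eq_Rintegral do rewrite -cosD.
rewrite /Rintegral fineK; first by rewrite unlock.
exact: (integrable_fin_num measurableT (integrable_cos a t)).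
Qed.

(** This is [Re (e^(i a) phi(t))] with [phi(t)] in polar form; the phase [b]
    does not depend on [a]. *)
Lemma expectation_cosD_polar (t : R) : exists b, forall a,
  ('E_P[fun w => cos (a + t * X w)%R])%E =
  (complex.Re `|char_fun X t| * cos (a + b))%:E.
Proof.
have E a := expectation_cosD a t; move: E; rewrite normc_def.
case: (char_fun X t) => x y /= E.
have [b [xb yb]] := polar_coordinates _ x y.
exists b => a; rewrite E cosD mulrBr.
by congr (_ - _)%:E; rewrite [RHS]mulrCA -?xb -?yb.
Qed.

(** Both bounds use the same phase [b]: the cosine is at most 1, and the shift
    [a = - b] makes it equal to 1. *)
Lemma best_payoff_cos (t : R) :
  best_payoff X (cos_payoff R) t = (complex.Re `|char_fun X t|)%:E.
Proof.
have [b Eb] := expectation_cosD_polar t.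
apply/eqP; rewrite eq_le; apply/andP; split.
- apply: ge_ereal_sup => _ [a _ <-]; rewrite Eb lee_fin ler_piMr ?cos_le1//.
  by rewrite normc_def/= sqrtr_ge0.
- apply: ereal_sup_ubound; exists (- b) => //.
  by rewrite Eb addNr cos0 mulr1.
Qed.

Lemma norm_char_fun0 : `|char_fun X 0| = 1.
Proof.
have E1 : ('E_P[fun w => cos (0 * X w)%R] = 1)%E.
  by under eq_fun do rewrite mul0r cos0; exact: expectation_cst.
have E0 : ('E_P[fun w => sin (0 * X w)%R] = 0)%E.
  by under eq_fun do rewrite mul0r sin0; exact: expectation_cst.
by rewrite /char_fun /cexpectation /= E1 E0 normr1.
Qed.

(** The order of [R[i]] is partial; moduli are real, so on them it is the order
    of the real parts, in which the best payoffs are expressed. *)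
Lemma norm_char_fun_le (s t : R) :
  (`|char_fun X s| <= `|char_fun X t|) =
  (complex.Re `|char_fun X s| <= complex.Re `|char_fun X t|).
Proof. by rewrite !normc_def lecR. Qed.

(** [|phi(t)|] is one of the values [E cos(a + t X)], each of which is an
    average of numbers at most 1. *)
Lemma norm_char_fun_le1 (t : R) : `|char_fun X t| <= 1.
Proof.
have [b Eb] := expectation_cosD_polar t.
rewrite -norm_char_fun0 norm_char_fun_le norm_char_fun0.
have -> : complex.Re `|char_fun X t| = \int[P]_w cos (- b + t * X w).
  by rewrite -fine_expectation Eb addNr cos0 mulr1.
have -> : complex.Re (1 : R[i]) = \int[P]_w (1 : R).
  by rewrite -(fine_expectation (cst 1)) expectation_cst.
by apply: le_Rintegral => //; exact: finite_measure_integrable_cst.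
Qed.

End CharacteristicFunction.

Theorem theorem1p8 (d : measure_display) (T : measurableType d) (R : realType)
    (P : probability T R) (X : {RV P >-> R}) :
  reasonable X (cos_payoff R) <->
  {in `[0, +oo[ &, nonincreasing_fun (fun t : R => `|char_fun X t|)}.
Proof.
split=> [Xcos s t|phi s t]; rewrite !in_itv/= !andbT => s0 t0 st.
- move: s0; rewrite le_eqVlt => /predU1P[<-|s0].
    by rewrite norm_char_fun0 norm_char_fun_le1.
  have := Xcos s t; rewrite !in_itv/= !andbT => /(_ s0 (lt_le_trans s0 st) st).
  by rewrite !best_payoff_cos lee_fin norm_char_fun_le.
- rewrite !best_payoff_cos lee_fin -norm_char_fun_le.
  by apply: phi st; rewrite in_itv/= andbT ltW.
Qed.
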